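(* For every balanced design $\mathbf{X}\in\mathscr{U}(n,q^s)$, the deviation pattern $(B_1,\dots,B_s)$ and the word-length pattern $(A_1,\dots,A_s)$ are linearly related by $$B_j^2(\mathbf{X})=\frac{n^2}{q^{2j}}\sum_{k=1}^{j}\binom{s-k}{j-k}A_k(\mathbf{X})\qquad\text{for } j=1,\dots,s.$$ Their benchmarks are given by $(0,A_2^*,\dots,A_s^* )$ and $(0,B_2^*,\dots,B_s^* )$, in which, for $j=2,\dots,s$, $$A_j^*=\left(1-\frac1n\right)\Big((1-f)P_j(s-\theta;s,q)+fP_j(s-\theta-1;s,q)\Big)+\frac{(q-1)^j}{n}\binom{s}{j},$$ $$B_j^*=\sqrt{\frac{n(n-1)}{q^j}\left(\binom{\theta}{j}+f\binom{\theta}{j-1}\right)-\binom{s}{j}\left(\frac{n^2}{q^{2j}}-\frac{n}{q^j}\right)},$$ in the sense that $(0,A_2^*,\dots,A_s^* )\models(0,A_2(\mathbf{X}),\dots,A_s(\mathbf{X}))$, while $B_j^*\le B_j(\mathbf{X})$ for all $j$ simultaneously.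
   Context: Let $\mathcal{L}(q^s)=\{0,1,\dots,q-1\}^s$. A lattice design $\mathbf{X}(n,q^s)$ is a collection of $n$ points (runs, repetitions allowed) $\mathbf{x}_1,\dots,\mathbf{x}_n\in\mathcal{L}(q^s)$, written as an $n\times s$ matrix $(x_{ij})$ whose columns correspond to factors; it is balanced if in each column the $q$ levels appear equally often. $\mathscr{U}(n,q^s)$ is the set of balanced designs. The coincidence of two runs is $\beta(\mathbf{x}_i,\mathbf{x}_k)=\sum_{j=1}^s\delta_{x_{ij},x_{kj}}$ (Kronecker delta); with $m=n(n-1)/2$, let $\beta_1,\dots,\beta_m$ be the list of $\beta(\mathbf{x}_i,\mathbf{x}_k)$ for $1\le i<k\le n$. Binomial convention: $\binom{x}{j}=0$ if $x<j$ and $\frac1{j!}x(x-1)\cdots(x-j+1)$ otherwise. Deviation pattern: for $j=1,\dots,s$, $B_j(\mathbf{X})=\sqrt{q^{-j}\,\Psi_C(\mathbf{X};j)}$, where $\Psi_C(\mathbf{X};j)=2\sum_{r=1}^m\binom{\beta_r}{j}-\binom{s}{j}\left(\frac{n^2}{q^j}-n\right)$ (this quantity is nonnegative). (Generalized) word-length pattern: for $j=1,\dots,s$, $A_j(\mathbf{X})=\frac{1}{n^2}\|\mathbf{G}_j\|_F^2$, where $\mathbf{G}_j$ is the matrix consisting of all $j$-factor contrast coefficients (with respect to orthonormal contrasts) in the ANOVA decomposition model and $\|\cdot\|_F$ is the Frobenius norm; equivalently, $$A_j(\mathbf{X})=\frac1n\sum_{l=0}^s E_l(\mathbf{X})P_j(l;s,q),\qquad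 E_l(\mathbf{X})=\frac1n\big|\{(i,k):\ 1\le i,k\le n,\ \beta(\mathbf{x}_i,\mathbf{x}_k)=s-l\}\big|,$$ with Krawtchouk polynomials $P_j(x;s,q)=\sum_{w=0}^j(-1)^w(q-1)^{j-w}\binom{x}{w}\binom{s-x}{j-w}$. For balanced designs $A_1=B_1=0$. Ordering: for two patterns $\mathbf{x},\mathbf{y}\in\mathbb{R}_+^s$, $\mathbf{x}\models\mathbf{y}$ means that either $\mathbf{x}=\mathbf{y}$ or the first nonzero element of $\mathbf{x}-\mathbf{y}$ is negative. $\theta$ and $f$ are the integral and fractional parts of $\bar\beta=\frac{s(n-q)}{q(n-1)}$, the mean of $\beta_1,\dots,\beta_m$ for any balanced design: $\theta=\lfloor\bar\beta\rfloor$, $f=\bar\beta-\theta$. *)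

(* Defs.v *)
From mathcomp Require Import all_boot all_order all_algebra.
From mathcomp Require Import reals.

Set Implicit Arguments.
Unset Strict Implicit.
Unset Printing Implicit Defensive.

Import Order.TTheory GRing.Theory Num.Theory.
Local Open Scope ring_scope.

(* The n runs are the rows of X, with repetitions allowed. *)
Definition design (n s q : nat) := 'M['I_q]_(n, s).

Definition balanced (n s q : nat) (X : design n s q) : Prop :=
  forall (j : 'I_s) (a b : 'I_q),
    #|[set i | X i j == a]| = #|[set i | X i j == b]|.

Definition coincidence (n s q : nat) (X : design n s q) (i k : 'I_n) : nat :=
  (\sum_(j < s) (X i j == X k j))%N.

Definition PsiC (R : realType) (n s q : nat) (X : design n s q) (j : nat) : R :=
  2 * (\sum_(i < n) \sum_(k < n | (i < k)%N) 'C(coincidence X i k, j)%:R)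
  - 'C(s, j)%:R * (n%:R ^+ 2 / q%:R ^+ j - n%:R).

Definition deviation (R : realType) (n s q : nat) (X : design n s q) (j : nat)
    : R :=
  Num.sqrt (PsiC R X j / q%:R ^+ j).

(* Row a of C is a contrast on the q levels; the q - 1 contrasts are orthonormal
   with respect to the uniform probability on the levels. With this
   normalization, sum_a C a x * C a y = q * (x == y) - 1, which gives
   A_j = n^-2 * sum_(i, k) P_j(s - beta(x_i, x_k); s, q). *)
Definition orthonormal_contrasts (R : realType) (q : nat)
    (C : 'M[R]_(q.-1, q)) : Prop :=
  (forall a, \sum_(x < q) C a x = 0) /\
  (forall a b, q%:R^-1 * \sum_(x < q) C a x * C b x = (a == b)%:R).

(* A factorial effect: [e l = None] if factor l is not involved, and
   [e l = Some a] if it enters through its contrast a. *)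
Definition effect (s q : nat) := {ffun 'I_s -> option 'I_q.-1}.

Definition effect_order (s q : nat) (e : effect s q) : nat :=
  #|[set l | e l != None]|.

(* The entry, in the row of run i and the column of effect e, of the model
   matrix of the ANOVA decomposition; c l lists the contrasts of factor l. *)
Definition model_coef (R : realType) (n s q : nat)
    (c : 'I_s -> 'M[R]_(q.-1, q)) (X : design n s q) (i : 'I_n)
    (e : effect s q) : R :=
  \prod_(l < s) (if e l is Some a then c l a (X i l) else 1).

(* The contrast coefficient of e is the e-th column sum of the model matrix; G_j
   collects those of all the j-factor effects. *)
Definition contrast_coef (R : realType) (n s q : nat)
    (c : 'I_s -> 'M[R]_(q.-1, q)) (X : design n s q) (e : effect s q) : R :=
  \sum_(i < n) model_coef c X i e.

Definition wordlength (R : realType) (n s q : nat)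
    (c : 'I_s -> 'M[R]_(q.-1, q)) (X : design n s q) (j : nat) : R :=
  (n%:R ^+ 2)^-1 *
  \sum_(e : effect s q | effect_order e == j) contrast_coef c X e ^+ 2.

(* Used for x <= s only, so that the subtraction s - x is exact. *)
Definition krawtchouk (R : realType) (j x s q : nat) : R :=
  \sum_(w < j.+1) (-1) ^+ w * (q%:R - 1) ^+ (j - w) *
                  'C(x, w)%:R * 'C(s - x, j - w)%:R.

Definition mean_coincidence (R : realType) (n s q : nat) : R :=
  (s%:R * (n%:R - q%:R)) / (q%:R * (n%:R - 1)).

(* The mean coincidence of a balanced design is nonnegative, hence truncn is its
   floor. *)
Definition theta (R : realType) (n s q : nat) : nat :=
  Num.truncn (mean_coincidence R n s q).

Definition frac (R : realType) (n s q : nat) : R :=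
  mean_coincidence R n s q - (theta R n s q)%:R.

(* If q > 1 and s > 0, then theta < s and both subtractions in nat are exact; if q = 1,
   then theta = s, and s - theta - 1 is truncated but has coefficient frac = 0. *)
Definition wordlength_star (R : realType) (n s q j : nat) : R :=
  let th := theta R n s q in
  let f := frac R n s q in
  (1 - n%:R^-1) * ((1 - f) * krawtchouk R j (s - th) s q
                   + f * krawtchouk R j (s - th - 1) s q)
  + (q%:R - 1) ^+ j / n%:R * 'C(s, j)%:R.

(* The radicand can be negative (for instance n = 8, s = q = j = 2); Num.sqrt is
   then 0. Only used for j >= 2. *)
Definition deviation_star (R : realType) (n s q j : nat) : R :=
  let th := theta R n s q in
  let f := frac R n s q in
  Num.sqrt (n%:R * (n%:R - 1) / q%:R ^+ j *
              ('C(th, j)%:R + f * 'C(th, j - 1)%:R)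
            - 'C(s, j)%:R * (n%:R ^+ 2 / q%:R ^+ (2 * j) - n%:R / q%:R ^+ j)).

(* The pattern (0, F 2, ..., F s): the column j : 'I_s carries the index j + 1. *)
Definition pattern0 (R : realType) (s : nat) (F : nat -> R) : 'rV[R]_s :=
  \row_(j < s) (if j == 0%N :> nat then 0 else F j.+1).

(* Stated on all of R^s, since wordlength_star may be negative. *)
Definition pattern_le (R : realType) (s : nat) (x y : 'rV[R]_s) : Prop :=
  x = y \/
  exists2 i : 'I_s, (x - y) 0 i < 0 &
    forall k : 'I_s, (k < i)%N -> (x - y) 0 k = 0.

(* Main.v *)
(** The word-length pattern is a sum over pairs of runs. Since the contrasts
are orthonormal, [\sum_a C a x * C a y = q * (x == y) - 1], so summing over the
effects of order j amounts to taking the coefficient of degree j in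
[\prod_l (1 + (q d_l - 1) X) = (1 + (q - 1) X)^b (1 - X)^(s - b)], where [d_l]
tells whether the two runs agree on factor l and b is their coincidence: this
is [P_j(s - b; s, q)]. Expanding instead [\prod_l (1 + (1 + a_l) X)] with
[a_l = q d_l - 1] gives [q^j 'C(b, j) = \sum_k 'C(s - k, j - k) P_k(s - b)],
whose sum over all pairs is the linear relation.

Balance fixes the mean [theta + f] of the coincidences of distinct runs. The
bound on B_j is the discrete convexity of ['C(b, j)] in b. For A_j, the
difference between [P_2(s - b)] and its chord through theta and theta + 1 is
[q^2 / 2 * (b - theta) (b - theta - 1) >= 0]. Hence either A_2* < A_2, or every
coincidence is theta or theta + 1, and then A_j* = A_j for all j. *)

Require Import Defs.
From mathcomp Require Import all_boot all_order all_algebra.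
From mathcomp Require Import reals ring lra zify.

Set Implicit Arguments.
Unset Strict Implicit.
Unset Printing Implicit Defensive.

Import Order.TTheory GRing.Theory Num.Theory.
Local Open Scope ring_scope.

(** * Generating functions and Krawtchouk polynomials *)

Lemma prod_addM (A : comNzRingType) (s : nat) (u v : A) (a : 'I_s -> A) :
  \prod_(l < s) (u + a l * v) =
  \sum_(S : {set 'I_s}) (\prod_(l in S) a l) * v ^+ #|S| * u ^+ (s - #|S|).
Proof.
under eq_bigr do rewrite addrC.
rewrite bigA_distr; apply: eq_big => [S|S _]; first by rewrite inE.
rewrite (bigID (mem S)) /= -prodr_const -big_split /=.
congr (_ * _); first by apply: eq_bigr => l ->.
rewrite (eq_bigr (fun=> u)) => [|l /negbTE -> //].
rewrite prodr_const; congr (_ ^+ _).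
apply: (canRL (addKn #|S|)); rewrite -[RHS]card_ord; exact: (cardC (mem S)).
Qed.

Lemma coef_exp_1DZX (A : comNzRingType) (c : A) (n k : nat) :
  ((1 + c *: 'X) ^+ n)`_k = c ^+ k * 'C(n, k)%:R.
Proof.
rewrite exprDn coef_sum.
under eq_bigr => i _ do
  rewrite expr1n mul1r exprZn coefMn coefZ coefXn mulrnAr.
have [kn|kn] := ltnP k n.+1; last first.
  rewrite bin_small // mulr0 big1 // => i _.
  by rewrite gtn_eqF ?mul0rn // (leq_trans (ltn_ord i)).
rewrite (bigD1 (Ordinal kn)) //= eqxx big1 ?addr0 ?mulr_natr ?mulr1 // => i.
by rewrite -val_eqE eq_sym /= => /negbTE ->; rewrite mul0rn.
Qed.

Lemma coef_prod_1DZX (A : comNzRingType) (s : nat) (a : 'I_s -> A) (k : nat) :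
  (\prod_(l < s) (1 + a l *: 'X))`_k =
  \sum_(S : {set 'I_s} | #|S| == k) \prod_(l in S) a l.
Proof.
under eq_bigr do rewrite -mul_polyC.
rewrite prod_addM coef_sum [RHS]big_mkcond; apply: eq_bigr => S _.
rewrite expr1n mulr1 -rmorph_prod coefCM coefXn eq_sym.
by case: eqP; rewrite ?mulr1 ?mulr0.
Qed.

(** Split each factor as [(1 + X) + a_l X]. Choosing the second summand on a set of size k leaves
    [X^k (1 + X)^(s - k)], whose coefficient of degree j is ['C(s - k, j - k)]. *)
Lemma coef_prod_1D1DZX (A : comNzRingType) (s : nat) (a : 'I_s -> A) (j : nat) :
  (\prod_(l < s) (1 + (1 + a l) *: 'X))`_j =
  \sum_(k < j.+1) 'C(s - k, j - k)%:R * (\prod_(l < s) (1 + a l *: 'X))`_k.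
Proof.
under eq_bigr do rewrite scalerDl addrA -[_ *: 'X in X in _ + X]mul_polyC.
rewrite prod_addM coef_sum.
under eq_bigr do rewrite -rmorph_prod /= -mulrA coefCM coefXnM coef_exp_1DZX
  expr1n mul1r.
(* Sets with more than j elements contribute nothing, since [X^#|S|] divides their term; the others
   are grouped by size. *)
rewrite (bigID (fun S : {set 'I_s} => #|S| < j.+1)%N) /= addrC big1 => [|S].
  rewrite add0r (partition_big (fun S : {set 'I_s} => inord #|S| : 'I_j.+1)
    predT) //=; apply: eq_bigr => k _.
  rewrite coef_prod_1DZX mulr_sumr; apply: eq_big => [S|S].
    have [lt|ge] := ltnP #|S| j.+1; first by rewrite -val_eqE /= inordK.
    by rewrite gtn_eqF // (leq_trans (ltn_ord k)).
  by case/andP=> lt /eqP <-; rewrite inordK // ltnNge -ltnS lt /= mulrC.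
by rewrite -leqNgt => ->; rewrite mulr0.
Qed.

(** The defining sum is the Cauchy product of [(1 - X)^(s - b)] and [(1 + (q - 1) X)^b], where
    [b <= s] gives [s - (s - b) = b]. *)
Lemma krawtchoukE (R : realType) (s q b j : nat) : (b <= s)%N ->
  krawtchouk R j (s - b) s q =
  ((1 + (q%:R - 1) *: 'X) ^+ b * (1 - 'X) ^+ (s - b))`_j.
Proof.
move=> bs; rewrite mulrC coefM; apply: eq_bigr => w _.
rewrite -scaleN1r !coef_exp_1DZX subKn //; ring.
Qed.

Lemma krawtchouk_sum (R : realType) (s q b j : nat) : (b <= s)%N ->
  \sum_(k < j.+1) 'C(s - k, j - k)%:R * krawtchouk R k (s - b) s q =
  q%:R ^+ j * 'C(b, j)%:R.
Proof.
move=> bs.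
have prodE (F G : {poly R}) :
    \prod_(l < s) (if (l < b)%N then F else G) = F ^+ b * G ^+ (s - b).
  rewrite (bigID (fun l : 'I_s => l < b)%N) /=; congr (_ * _).
    rewrite (eq_bigr (fun=> F)) => [|l -> //].
    by rewrite -(big_ord_widen s (fun=> F)) // prodr_const card_ord.
  rewrite (eq_bigr (fun=> G)) => [|l /negbTE -> //].
  rewrite prodr_const; congr (_ ^+ _).
  apply: (canRL (addKn b)); rewrite -[RHS]card_ord.
  rewrite -(cardC (fun l : 'I_s => l < b)%N); congr (_ + _)%N.
  rewrite -[RHS]sum1_card -(big_ord_widen s (fun=> 1%N)) //.
  by rewrite sum1_card card_ord.
(* Models two runs that agree exactly on the factors l < b. *)
pose a (l : 'I_s) : R := if (l < b)%N then q%:R - 1 else - 1.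
rewrite -coef_exp_1DZX.
(* Here [1 + a l] is q for [l < b] and 0 otherwise, so only b factors differ from 1. *)
have -> : (1 + q%:R *: 'X) ^+ b = \prod_(l < s) (1 + (1 + a l) *: 'X) :> {poly R}.
  rewrite -[LHS]mulr1 -[X in _ * X](expr1n _ (s - b)) -prodE; apply: eq_bigr => l _.
  by rewrite /a; case: ifP; rewrite ?subrr ?scale0r ?addr0 // [1 + (_ - _)]addrC subrK.
rewrite coef_prod_1D1DZX; apply: eq_bigr => k _; rewrite krawtchoukE // -prodE.
congr (_ * (polyseq _)`_k); apply: eq_bigr => l _.
by rewrite /a; case: ifP => // _; rewrite scaleN1r.
Qed.

(** * Contrasts, and both patterns as sums over pairs of runs *)

Lemma orthonormal_contrasts_kernel (R : realType) (q : nat)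
    (C : 'M[R]_(q.-1, q)) (x y : 'I_q) :
  orthonormal_contrasts C -> \sum_a C a x * C a y = q%:R * (x == y)%:R - 1.
Proof.
case: q C x y => [|q] C x y; first by case: x.
case=> /= C0 C1; have q0 : q.+1%:R != 0 :> R by rewrite pnatr_eq0.
(* The constant row completes the contrasts to a square matrix whose rows are orthonormal for the
   uniform probability. *)
pose M : 'M[R]_(1 + q, q.+1) := col_mx (const_mx 1) C.
have MMt : M *m (q.+1%:R^-1 *: M^T) = 1%:M.
  apply/matrixP=> i k; rewrite -scalemxAr !mxE mulr_sumr.
  under eq_bigr do rewrite !mxE.
  rewrite (_ : (i == k) = (i == k :> nat)) //.
  case: splitP => i' ii'; case: splitP => k' kk'.
  - rewrite ii' kk' (ord1 i') (ord1 k').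
    under eq_bigr do rewrite !mxE mul1r mulr1.
    by rewrite sumr_const card_ord -[LHS]mulr_natr mulVf.
  - rewrite ii' kk' (ord1 i') /=.
    by under eq_bigr do rewrite !mxE mul1r; rewrite -mulr_sumr C0 mulr0.
  - rewrite ii' kk' (ord1 k') /=.
    by under eq_bigr do rewrite !mxE mulr1; rewrite -mulr_sumr C0 mulr0.
  - by rewrite -mulr_sumr C1 ii' kk' eqn_add2l.
(* A right inverse of a square matrix is also a left inverse, which turns orthogonality of rows into
   orthogonality of columns; the constant row accounts for the [- 1]. *)
have /matrixP/(_ x y) := mulmx1C MMt.
rewrite -scalemxAl !mxE big_split_ord /= big_ord1 mxE /M !col_mxEu !mxE.
under eq_bigr do rewrite mxE !col_mxEd.
by move=> <-; rewrite mulVKf // mulr1 addrAC subrr add0r.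
Qed.
Lemma coincidence_sym (n s q : nat) (X : design n s q) (i k : 'I_n) :
  coincidence X i k = coincidence X k i.
Proof. by apply: eq_bigr => l _; rewrite eq_sym. Qed.

Lemma coincidence_diag (n s q : nat) (X : design n s q) (i : 'I_n) :
  coincidence X i i = s.
Proof.
by rewrite /coincidence; under eq_bigr do rewrite eqxx; rewrite sum1_card card_ord.
Qed.

Lemma coincidence_le (n s q : nat) (X : design n s q) (i k : 'I_n) :
  (coincidence X i k <= s)%N.
Proof.
rewrite -[leqRHS]card_ord -sum1_card.
by apply: leq_sum => l _; case: eqP.
Qed.

Lemma sum_model_coefM (R : realType) (n s q : nat) (c : 'I_s -> 'M[R]_(q.-1, q))
    (X : design n s q) (i k : 'I_n) (j : nat) :
  (forall l, orthonormal_contrasts (c l)) ->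
  \sum_(e : effect s q | effect_order e == j)
    model_coef c X i e * model_coef c X k e =
  krawtchouk R j (s - coincidence X i k) s q.
Proof.
move=> hc; rewrite krawtchoukE ?coincidence_le //.
pose t l (o : option 'I_q.-1) : R :=
  if o is Some a then c l a (X i l) * c l a (X k l) else 1.
(* The variable marks the factors involved: the product of the [F l (e l)] is a monomial of exponent
   [effect_order e], so the coefficient of degree j selects the effects of order j. *)
pose F l (o : option 'I_q.-1) : {poly R} := (t l o)%:P * 'X^(o != None).
have kern l : \sum_o F l o = 1 + (q%:R * (X i l == X k l)%:R - 1) *: 'X.
  rewrite (bigD1 None) //= /F /= mulr1; congr (_ + _).
  rewrite (reindex_omap Some id) /=; last by case.
  rewrite -(orthonormal_contrasts_kernel _ _ (hc l)) scaler_suml.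
  by apply: eq_big => [a|a _]; rewrite ?eqxx // mul_polyC.
have -> : (1 + (q%:R - 1) *: 'X) ^+ coincidence X i k *
    (1 - 'X) ^+ (s - coincidence X i k) = \prod_(l < s) \sum_o F l o :> {poly R}.
  have cE : coincidence X i k = #|[pred l | X i l == X k l]|.
    rewrite -sum1_card [RHS]big_mkcond /coincidence.
    by apply: eq_bigr => l _; rewrite inE; case: eqP.
  rewrite (bigID [pred l | X i l == X k l]) /= cE; congr (_ * _).
    by rewrite -prodr_const; apply: eq_bigr => l; rewrite inE kern => ->; rewrite mulr1.
  rewrite (eq_bigr (fun=> 1 - 'X)) => [|l /negbTE h]; last first.
    by rewrite kern h mulr0 add0r scaleN1r.
  rewrite prodr_const; congr (_ ^+ _); apply/esym.
  apply: (canRL (addKn _)); rewrite -[RHS]card_ord; exact: (cardC [pred l | X i l == X k l]).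
rewrite bigA_distr_bigA coef_sum [LHS]big_mkcond; apply: eq_bigr => e _.
have oE : (\sum_(l < s) (e l != None) = effect_order e)%N.
  rewrite /effect_order -sum1dep_card [RHS]big_mkcond.
  by apply: eq_bigr => l _; case: (e l).
rewrite big_split /= -rmorph_prod /= coefCM prodrXr coefXn oE eq_sym -big_split /=.
case: eqP => _; rewrite ?mulr0 // mulr1; apply: eq_bigr => l _.
by rewrite /t; case: (e l) => //; rewrite mulr1.
Qed.

Lemma wordlengthE (R : realType) (n s q : nat) (c : 'I_s -> 'M[R]_(q.-1, q))
    (X : design n s q) (j : nat) :
  (forall l, orthonormal_contrasts (c l)) ->
  wordlength c X j = (n%:R ^+ 2)^-1 *
    \sum_(i < n) \sum_(k < n) krawtchouk R j (s - coincidence X i k) s q.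
Proof.
move=> hc; congr (_ * _).
under eq_bigr do rewrite expr2 big_distrlr /=.
rewrite exchange_big; apply: eq_bigr => i _.
by rewrite exchange_big; apply: eq_bigr => k _; rewrite sum_model_coefM.
Qed.

Lemma sum_sym (R : comNzRingType) (n : nat) (F : 'I_n -> 'I_n -> R) :
  (forall i k, F i k = F k i) ->
  \sum_i \sum_k F i k = 2 * \sum_(i < n) \sum_(k < n | (i < k)%N) F i k + \sum_i F i i.
Proof.
move=> Fsym; rewrite mulr2n mulrDl !mul1r.
rewrite [X in _ + X + _](_ : _ = \sum_(i < n) \sum_(k < n | (k < i)%N) F i k).
  rewrite -!big_split /=; apply: eq_bigr => i _.
  rewrite (bigID (fun k : 'I_n => i < k)%N) /= -addrA; congr (_ + _).
  rewrite (bigD1 i) /= ?ltnn // addrC; congr (_ + _).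
  by apply: eq_bigl => k; rewrite -leqNgt -val_eqE /= ltn_neqAle andbC.
under eq_bigr do rewrite big_mkcond.
rewrite exchange_big; apply: eq_bigr => i _.
by rewrite [RHS]big_mkcond; apply: eq_bigr => k _; rewrite Fsym.
Qed.

(** The term [n 'C(s, j)] of [PsiC] is the contribution of the diagonal pairs, as a run coincides
    with itself on all s factors. *)
Lemma PsiCE (R : realType) (n s q : nat) (X : design n s q) (j : nat) :
  PsiC R X j = \sum_i \sum_k 'C(coincidence X i k, j)%:R
               - 'C(s, j)%:R * (n%:R ^+ 2 / q%:R ^+ j).
Proof.
rewrite sum_sym => [|i k]; last by rewrite coincidence_sym.
under [X in _ + X - _]eq_bigr do rewrite coincidence_diag.
rewrite sumr_const card_ord -[_ *+ n]mulr_natr /PsiC; ring.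
Qed.

Lemma krawtchouk0 (R : realType) (x s q : nat) : krawtchouk R 0 x s q = 1.
Proof. by rewrite /krawtchouk big_ord1 !bin0 !mulr1. Qed.

Lemma PsiC_wordlength (R : realType) (n s q : nat) (c : 'I_s -> 'M[R]_(q.-1, q))
    (X : design n s q) (j : nat) :
  (0 < n)%N -> (0 < q)%N -> (forall l, orthonormal_contrasts (c l)) ->
  PsiC R X j / q%:R ^+ j = n%:R ^+ 2 / q%:R ^+ (2 * j) *
    \sum_(1 <= k < j.+1) 'C(s - k, j - k)%:R * wordlength c X k.
Proof.
move=> n0 q0 hc; have nz : n%:R != 0 :> R by rewrite pnatr_eq0 -lt0n.
have qz : q%:R ^+ j != 0 :> R by rewrite expf_neq0 // pnatr_eq0 -lt0n.
have key : \sum_(k < j.+1) 'C(s - k, j - k)%:R * wordlength c X k =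
    (n%:R ^+ 2)^-1 * (q%:R ^+ j * \sum_i \sum_k 'C(coincidence X i k, j)%:R).
  under eq_bigr do rewrite wordlengthE // mulrCA.
  rewrite -mulr_sumr; congr (_ * _).
  under eq_bigr do rewrite mulr_sumr.
  rewrite exchange_big mulr_sumr; apply: eq_bigr => i _.
  under eq_bigr do rewrite mulr_sumr.
  rewrite exchange_big mulr_sumr; apply: eq_bigr => k _.
  by rewrite krawtchouk_sum // coincidence_le.
(* The term [k = 0] of [key] is then ['C(s, j)], which matches the term subtracted in [PsiCE]; the
   sum in the statement starts at 1. *)
have w0 : wordlength c X 0 = 1.
  rewrite wordlengthE //; under eq_bigr do under eq_bigr do rewrite krawtchouk0.
  rewrite (eq_bigr (fun=> n%:R)) => [|i _]; last by rewrite sumr_const card_ord.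
  by rewrite sumr_const card_ord -[X in _ * X]mulr_natr -expr2 mulVf ?expf_neq0.
move: key; rewrite -(big_mkord predT (fun k => 'C(s - k, j - k)%:R * wordlength c X k)).
rewrite big_ltn // !subn0 w0 mulr1 PsiCE => /(canRL (addKr _)) ->.
by rewrite mulnC exprM; field; rewrite nz qz.
Qed.

(** * Balance, and convexity in the coincidence *)

Lemma sum_coincidence (R : realType) (n s q : nat) (X : design n s q) :
  balanced X ->
  q%:R * \sum_i \sum_k (coincidence X i k)%:R = s%:R * n%:R ^+ 2 :> R.
Proof.
move=> hX.
(* By balance every level fills n/q entries of a column, so each factor contributes [n^2 / q] to the
   sum over ordered pairs. *)
have level l i : (q * #|[set k | X k l == X i l]| = n)%N.
  transitivity (\sum_(a < q) #|[set k | X k l == a]|)%N; last first.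
    under eq_bigr do rewrite -sum1dep_card.
    rewrite -[RHS](card_ord n) -sum1_card.
    by rewrite (partition_big (fun k => X k l) predT).
  rewrite (eq_bigr (fun=> #|[set k | X k l == X i l]|)) => [|a _]; last exact: hX.
  by rewrite sum_nat_const card_ord.
suff sumE : (q * \sum_i \sum_k coincidence X i k = s * n ^ 2)%N.
  rewrite -natrX -natrM -sumE natrM natr_sum; congr (_ * _).
  by apply: eq_bigr => i _; rewrite natr_sum.
under eq_bigr do rewrite exchange_big /=.
rewrite exchange_big big_distrr /= -[s in RHS]card_ord -sum_nat_const.
apply: eq_bigr => l _; rewrite big_distrr /= expnS expn1 -[X in (X * _)%N]card_ord.
rewrite -sum_nat_const; apply: eq_bigr => i _; rewrite -[RHS](level l i).
congr (_ * _)%N; rewrite -sum1dep_card [RHS]big_mkcond.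
by apply: eq_bigr => k _; rewrite eq_sym; case: eqP.
Qed.

(** By Pascal's rule the increments of ['C(-, j.+1)] are the values of ['C(-, j)], which are
    nondecreasing. The left side is thus the chord of a convex sequence through t and [t + 1],
    extended to all b. *)
Lemma bin_tangent (R : realType) (b t j : nat) :
  'C(t, j.+1)%:R + (b%:R - t%:R) * 'C(t, j)%:R <= 'C(b, j.+1)%:R :> R.
Proof.
have [tb|/ltnW bt] := leqP t b.
  suff H d : ('C(t, j.+1) + d * 'C(t, j) <= 'C(t + d, j.+1))%N.
    by have := H (b - t)%N; rewrite subnKC // -(ler_nat R) natrD natrM natrB.
  elim: d => [|d IH]; first by rewrite mul0n !addn0.
  rewrite addnS binS mulSn addnCA addnC leq_add //.
  by rewrite leq_bin2l // leq_addr.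
suff H d : ('C(b + d, j.+1) <= 'C(b, j.+1) + d * 'C(b + d, j))%N.
  have := H (t - b)%N; rewrite subnKC // -(ler_nat R) natrD natrM natrB //; lra.
elim: d => [|d IH]; first by rewrite mul0n !addn0.
have le : ('C(b + d, j) <= 'C(b + d.+1, j))%N by rewrite leq_bin2l // leq_add2l.
rewrite {1}addnS binS mulSn.
apply: leq_trans (leq_add IH le) _; rewrite -addnA leq_add2l addnC leq_add2l.
by rewrite leq_mul2l le orbT.
Qed.

Lemma bin2_natr (R : realType) (n : nat) :
  'C(n, 2)%:R = n%:R * (n%:R - 1) / 2 :> R.
Proof.
elim: n => [|n IH]; first by rewrite bin0n mul0r mul0r.
by rewrite binS bin1 natrD IH -natr1; field.
Qed.

Lemma krawtchouk2 (R : realType) (b s q : nat) : (b <= s)%N ->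
  krawtchouk R 2 (s - b) s q =
  (q%:R - 1) ^+ 2 * (b%:R * (b%:R - 1) / 2)
  - (q%:R - 1) * (s%:R - b%:R) * b%:R
  + (s%:R - b%:R) * (s%:R - b%:R - 1) / 2.
Proof.
move=> bs; rewrite /krawtchouk !big_ord_recr big_ord0 /= subKn //.
by rewrite !subn0 !subSS subn0 !bin0 !bin1 !bin2_natr natrB //; field.
Qed.

(* A second order Newton expansion at t: the second difference in b of
   P_2(s - b; s, q) is q^2. *)
Lemma krawtchouk2_newton (R : realType) (b t s q : nat) :
  (b <= s)%N -> (t < s)%N ->
  krawtchouk R 2 (s - b) s q =
  krawtchouk R 2 (s - t) s q
  + (b%:R - t%:R) * (krawtchouk R 2 (s - t - 1) s q - krawtchouk R 2 (s - t) s q)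
  + q%:R ^+ 2 / 2 * ((b%:R - t%:R) * (b%:R - t%:R - 1)).
Proof.
move=> bs ts; rewrite -subnDA addn1 !krawtchouk2 //; last exact: ltnW.
by rewrite -natr1; field.
Qed.

Lemma natr_consecutive_ge0 (R : realType) (b t : nat) :
  0 <= (b%:R - t%:R) * (b%:R - t%:R - 1) :> R.
Proof.
have [bt|tb] := leqP b t.
  by rewrite mulr_le0 ?subr_le0 ?ler_nat // lerBlDr nat1r ler_nat leqW.
by rewrite mulr_ge0 ?subr_ge0 ?ler_nat ?(ltnW tb) // lerBrDr nat1r ler_nat.
Qed.

(** * Pair sums of affine functions of the coincidence, and the deviation benchmark *)

Lemma sum_pairs_const (R : realType) (n : nat) (x : R) :
  \sum_(i < n) \sum_(k < n | (i < k)%N) x = n%:R * (n%:R - 1) / 2 * x.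
Proof.
have := sum_sym (fun i k : 'I_n => erefl x).
under eq_bigr do rewrite sumr_const card_ord.
rewrite !sumr_const card_ord -[x *+ n *+ n]mulr_natr -[x *+ n]mulr_natr => h.
lra.
Qed.

(** Remove the diagonal, worth [n s], from [sum_coincidence] and halve. *)
Lemma sum_pairs_coincidence (R : realType) (n s q : nat) (X : design n s q) :
  (1 < n)%N -> (0 < q)%N -> balanced X ->
  \sum_(i < n) \sum_(k < n | (i < k)%N) (coincidence X i k)%:R =
  n%:R * (n%:R - 1) / 2 * mean_coincidence R n s q.
Proof.
move=> n1 q0 hX.
have nz : n%:R - 1 != 0 :> R by rewrite subr_eq0 pnatr_eq1 gtn_eqF.
have qz : q%:R != 0 :> R by rewrite pnatr_eq0 -lt0n.
apply: (mulfI qz); have := sum_coincidence R hX.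
rewrite sum_sym => [|i k]; last by rewrite coincidence_sym.
under [X in _ * (_ + X)]eq_bigr do rewrite coincidence_diag.
rewrite sumr_const card_ord -[s%:R *+ n]mulr_natr /mean_coincidence.
move=> h.
have -> : q%:R * (n%:R * (n%:R - 1) / 2 * (s%:R * (n%:R - q%:R) / (q%:R * (n%:R - 1)))) =
   n%:R * (s%:R * (n%:R - q%:R)) / 2 :> R by field; rewrite qz nz.
lra.
Qed.

(* Unqualified, [frac] is the fraction constructor of MathComp's fraction.v. *)
Lemma sum_pairs_affine (R : realType) (n s q : nat) (X : design n s q) (x y : R) :
  (1 < n)%N -> (0 < q)%N -> balanced X ->
  \sum_(i < n) \sum_(k < n | (i < k)%N)
     (x + ((coincidence X i k)%:R - (theta R n s q)%:R) * y) =
  n%:R * (n%:R - 1) / 2 * (x + Defs.frac R n s q * y).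
Proof.
move=> n1 q0 hX.
pose u := x - (theta R n s q)%:R * y.
transitivity (\sum_(i < n) \sum_(k < n | (i < k)%N) (u + (coincidence X i k)%:R * y)).
  by apply: eq_bigr => i _; apply: eq_bigr => k _; rewrite /u; ring.
under eq_bigr do rewrite big_split /= -mulr_suml.
rewrite big_split /= -mulr_suml sum_pairs_const (sum_pairs_coincidence R n1 q0 hX).
by rewrite /u /Defs.frac; ring.
Qed.

(** The design X shows that the mean is an average of natural numbers, hence nonnegative, so that
    [truncn] is its floor. *)
Lemma frac_ge0 (R : realType) (n s q : nat) (X : design n s q) :
  (1 < n)%N -> (0 < q)%N -> balanced X -> 0 <= Defs.frac R n s q.
Proof.
move=> n1 q0 hX; rewrite subr_ge0.
have m0 : 0 < n%:R * (n%:R - 1) / 2 :> R.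
  by rewrite divr_gt0 // mulr_gt0 ?subr_gt0 ?ltr1n ?ltr0n // ltnW.
suff /truncn_itv/andP[] : 0 <= mean_coincidence R n s q by [].
rewrite -(pmulr_rge0 _ m0) -(sum_pairs_coincidence R n1 q0 hX).
by apply: sumr_ge0 => i _; apply: sumr_ge0.
Qed.

Lemma deviation_star_le (R : realType) (n s q : nat) (X : design n s q) (j : nat) :
  (1 < n)%N -> (0 < q)%N -> balanced X ->
  deviation_star R n s q j.+1 <= deviation R X j.+1.
Proof.
(* Comparing radicands is enough, even if the left one is negative. The tangent bound at [theta],
   summed over pairs, depends on the design only through the mean. *)
move=> n1 q0 hX; apply: ler_wsqrtr; rewrite /PsiC subn1 /=.
set S := \sum_(i < n) _.
have leS : n%:R * (n%:R - 1) / 2 * ('C(theta R n s q, j.+1)%:R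
    + Defs.frac R n s q * 'C(theta R n s q, j)%:R) <= S.
  rewrite -(sum_pairs_affine _ _ n1 q0 hX).
  by apply: ler_sum => i _; apply: ler_sum => k _; apply: bin_tangent.
rewrite mulnC exprM; set Q := q%:R ^+ j.+1.
have Q0 : 0 < Q by rewrite exprn_gt0 // ltr0n.
rewrite ler_pdivlMr //.
have -> : (n%:R * (n%:R - 1) / Q * ('C(theta R n s q, j.+1)%:R
    + Defs.frac R n s q * 'C(theta R n s q, j)%:R)
    - 'C(s, j.+1)%:R * (n%:R ^+ 2 / Q ^+ 2 - n%:R / Q)) * Q =
  2 * (n%:R * (n%:R - 1) / 2 * ('C(theta R n s q, j.+1)%:R
    + Defs.frac R n s q * 'C(theta R n s q, j)%:R))
    - 'C(s, j.+1)%:R * (n%:R ^+ 2 / Q - n%:R).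
  by field; rewrite gt_eqF.
by rewrite lerD2r ler_pM2l.
Qed.

(** * The word-length benchmark, by comparison with a chord *)

Definition chord_defect (R : realType) (n s q : nat) (j b : nat) : R :=
  let t := theta R n s q in
  krawtchouk R j (s - b) s q -
  (krawtchouk R j (s - t) s q + (b%:R - t%:R) *
     (krawtchouk R j (s - t - 1) s q - krawtchouk R j (s - t) s q)).

(** These b are the nodes of the chord. Truncated subtraction is harmless, since [s - t.+1] and
    [s - t - 1] agree in nat. *)
Lemma chord_defect_theta (R : realType) (n s q j b : nat) :
  b = theta R n s q \/ b = (theta R n s q).+1 -> chord_defect R n s q j b = 0.
Proof.
by case=> ->; rewrite /chord_defect -?natr1 -?subnDA ?addn1; ring.
Qed.

(** The diagonal pairs give the last term of [wordlength_star], and the chord, being affine in b,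
    sums over the other pairs to its first term; only the defects remain. *)
Lemma wordlength_sub_star (R : realType) (n s q : nat) (c : 'I_s -> 'M[R]_(q.-1, q))
    (X : design n s q) (j : nat) :
  (1 < n)%N -> (0 < q)%N -> balanced X -> (forall l, orthonormal_contrasts (c l)) ->
  wordlength c X j - wordlength_star R n s q j =
  2 / n%:R ^+ 2 *
  \sum_(i < n) \sum_(k < n | (i < k)%N) chord_defect R n s q j (coincidence X i k).
Proof.
move=> n1 q0 hX hc.
have nz : n%:R != 0 :> R by rewrite pnatr_eq0 gtn_eqF // ltnW.
under eq_bigr do rewrite sumrB; rewrite sumrB sum_pairs_affine //.
rewrite wordlengthE // sum_sym => [|i k]; last by rewrite coincidence_sym.
under [X in _ * (_ + X)]eq_bigr do rewrite coincidence_diag krawtchoukE // subnn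
  mulr1 coef_exp_1DZX.
rewrite sumr_const card_ord -[_ *+ n]mulr_natr /wordlength_star.
by field.
Qed.

Lemma wordlength_dichotomy (R : realType) (n s q : nat) (c : 'I_s -> 'M[R]_(q.-1, q))
    (X : design n s q) :
  (1 < n)%N -> (0 < q)%N -> balanced X -> (forall l, orthonormal_contrasts (c l)) ->
  wordlength_star R n s q 2 < wordlength c X 2 \/
  forall j, wordlength_star R n s q j = wordlength c X j.
Proof.
move=> n1 q0 hX hc.
set t := theta R n s q.
have c0 : 0 < 2 / n%:R ^+ 2 :> R by rewrite divr_gt0 // exprn_gt0 // ltr0n ltnW.
have eq_star : (forall i k : 'I_n, (i < k)%N ->
    coincidence X i k = t \/ coincidence X i k = t.+1) ->
    forall j, wordlength_star R n s q j = wordlength c X j.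
  move=> h j; apply/esym/eqP; rewrite -subr_eq0 wordlength_sub_star //.
  rewrite big1 ?mulr0 // => i _; rewrite big1 // => k ik.
  exact/chord_defect_theta/h.
(* The expansion [krawtchouk2_newton] needs [t < s]. Otherwise no coincidence exceeds t while their
   mean is at least t, so all equal t. *)
have [ts|st] := ltnP t s; last first.
  right; apply: eq_star => i k ik; left; apply/eqP.
  pose F (i k : 'I_n) : R := t%:R - (coincidence X i k)%:R.
  have F0 i' k' : 0 <= F i' k'.
    by rewrite subr_ge0 ler_nat (leq_trans (coincidence_le _ _ _)).
  have sF : \sum_(i < n) \sum_(k < n | (i < k)%N) F i k = 0.
    apply/eqP; rewrite eq_le sumr_ge0 ?andbT => [|i' _]; last exact: sumr_ge0.
    have := sum_pairs_affine (0 : R) (-1) n1 q0 hX; rewrite add0r mulrN1 => h.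
    have -> : \sum_(i < n) \sum_(k < n | (i < k)%N) F i k =
        n%:R * (n%:R - 1) / 2 * - Defs.frac R n s q.
      rewrite -h; apply: eq_bigr => i' _; apply: eq_bigr => k' _.
      by rewrite /F -/t; ring.
    rewrite mulr_ge0_le0 ?oppr_le0 ?(frac_ge0 R n1 q0 hX) //.
    by rewrite divr_ge0 // mulr_ge0 ?subr_ge0 // ler1n ltnW.
  have /(_ i isT) sFi := psumr_eq0P (fun i' _ => sumr_ge0 _ (fun k' _ => F0 i' k')) sF.
  have /(_ k ik)/eqP := psumr_eq0P (fun k' _ => F0 i k') sFi.
  by rewrite subr_eq0 eqr_nat eq_sym.
pose G (b : nat) : R := (b%:R - t%:R) * (b%:R - t%:R - 1).
have G0 b : 0 <= G b := natr_consecutive_ge0 R b t.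
have defE b : (b <= s)%N -> chord_defect R n s q 2 b = q%:R ^+ 2 / 2 * G b.
  by move=> bs; rewrite /chord_defect (krawtchouk2_newton R q bs ts) addrC addKr.
have q2 : 0 < q%:R ^+ 2 / 2 :> R by rewrite divr_gt0 // exprn_gt0 // ltr0n.
have sub2 : wordlength c X 2 - wordlength_star R n s q 2 = 2 / n%:R ^+ 2 *
    (q%:R ^+ 2 / 2 * \sum_(i < n) \sum_(k < n | (i < k)%N) G (coincidence X i k)).
  rewrite wordlength_sub_star //; congr (_ * _); rewrite mulr_sumr.
  apply: eq_bigr => i _; rewrite mulr_sumr; apply: eq_bigr => k _.
  by rewrite defE // coincidence_le.
set SG := \sum_(i < n) _ in sub2.
have SG0 : 0 <= SG by apply: sumr_ge0 => i _; apply: sumr_ge0.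
have [SGp|] := ltP 0 SG.
  by left; rewrite -subr_gt0 sub2 (pmulr_rgt0 _ c0) (pmulr_rgt0 _ q2).
(* A vanishing sum of nonnegative terms forces each [G] to vanish, and its roots are t and
   [t + 1]. *)
move=> SGle; have SGz : SG = 0 by apply/eqP; rewrite eq_le SGle.
right; apply: eq_star => i k ik.
have /(_ i isT) sGi := psumr_eq0P (fun i' _ => sumr_ge0 _ (fun k' _ => G0 _)) SGz.
have /(_ k ik)/eqP := psumr_eq0P (fun k' _ => G0 _) sGi.
rewrite mulf_eq0 -addrA -opprD natr1 !subr_eq0 !eqr_nat.
by case/orP=> /eqP ->; [left|right].
Qed.

Theorem theorem3 (R : realType) (n s q : nat) (hn : (1 < n)%N) (hq : (0 < q)%N)
    (c : 'I_s -> 'M[R]_(q.-1, q))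
    (hc : forall l : 'I_s, orthonormal_contrasts (c l))
    (X : design n s q) (hX : balanced X) :
  [/\ forall j : nat, (1 <= j <= s)%N ->
        deviation R X j ^+ 2 =
        n%:R ^+ 2 / q%:R ^+ (2 * j) *
        \sum_(1 <= k < j.+1) 'C(s - k, j - k)%:R * wordlength c X k,
      pattern_le (pattern0 s (wordlength_star R n s q))
                 (pattern0 s (wordlength c X))
    & forall j : 'I_s,
        pattern0 s (deviation_star R n s q) 0 j <= deviation R X j.+1 ].
Proof.
split=> [j _||j].
- have dE := PsiC_wordlength X j (ltnW hn) hq hc.
  (* The radicand is nonnegative because the linear relation writes it as a combination of sums of
     squares with nonnegative coefficients. *)
  rewrite sqr_sqrtr dE // mulr_ge0 ?divr_ge0 ?exprn_ge0 ?ler0n //.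
  apply: sumr_ge0 => k _; rewrite mulr_ge0 ?ler0n // /wordlength.
  by rewrite mulr_ge0 ?invr_ge0 ?exprn_ge0 ?ler0n // sumr_ge0 // => e _; apply: sqr_ge0.
(* For [s <= 1] no column carries an index above 1, and both patterns are zero. *)
- have [s1|s1] := leqP s 1.
    left; apply/rowP => k; rewrite !mxE.
    by case: eqP => // k0; have := ltn_ord k; lia.
  have [lt2|eqA] := wordlength_dichotomy hn hq hX hc; last first.
    by left; apply/rowP => k; rewrite !mxE eqA.
  (* Column 1 carries the index 2, and the only earlier column is 0 in both patterns. *)
  right; exists (Ordinal s1); first by rewrite !mxE /= subr_lt0.
  by case=> [[|k]] //= lk _; rewrite !mxE /= subrr.
- rewrite mxE; case: eqP => _; first exact: sqrtr_ge0.
  exact: deviation_star_le.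
Qed.
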